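(* For every proper planar metric $\rho$ on $\mathbb{R}^2$, $\chi((\mathbb{R}^2,\rho),\{1\})\ge 3$. Equivalently, every element of $\mathsf{PLANAR}^*$ is greater than $2$.
   Context: A planar metric is a metric $\rho$ on $\mathbb{R}^2$ that is translation invariant ($\rho(x,y)=\rho(x+v,y+v)$ for all $x,y,v$) and induces the usual topology on $\mathbb{R}^2$. It is proper if its closed balls $\{y:\rho(x,y)\le r\}$ are compact. $\mathsf{PLANAR}^*$ is the set of all values of $\chi((\mathbb{R}^2,\rho),\{1\})$ over proper planar metrics $\rho$, where $\chi(X,D)$ is the chromatic number of the graph on $X$ in which $x\sim y$ iff $\rho(x,y)\in D$. *)

(* Defs.v *)
From HB Require Import structures.
From mathcomp Require Import all_boot all_order all_algebra.
From mathcomp Require Import all_classical all_reals all_analysis.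

Set Implicit Arguments.
Unset Strict Implicit.
Unset Printing Implicit Defensive.

Import Order.TTheory GRing.Theory Num.Theory.
Import numFieldNormedType.Exports.

Local Open Scope classical_set_scope.
Local Open Scope ring_scope.

Definition colorable (T : Type) (adj : T -> T -> Prop) (n : nat) : Prop :=
  exists c : T -> 'I_n, forall x y : T, adj x y -> c x <> c y.

(* Since the infimum is taken over a set of natural numbers, it is a minimum
   when a finite colouring exists; it is +oo when there is none, i.e. infinite
   chromatic numbers are not told apart. *)
Definition chromatic_number (R : realType) (T : Type)
    (adj : T -> T -> Prop) : \bar R :=
  ereal_inf [set (n%:R)%:E | n in [set n : nat | colorable adj n]].

Definition dist_graph (R : realType) (T : Type) (rho : T -> T -> R)
    (D : set R) (x y : T) : Prop := D (rho x y).

Definition chi (R : realType) (T : Type) (rho : T -> T -> R) (D : set R) :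
    \bar R :=
  chromatic_number R (dist_graph rho D).

Definition is_metric (R : realType) (T : Type) (rho : T -> T -> R) : Prop :=
  [/\ forall x y, 0 <= rho x y,
      forall x y, rho x y = 0 <-> x = y,
      forall x y, rho x y = rho y x &
      forall x y z, rho x z <= rho x y + rho y z].

Definition translation_invariant (R : realType) (V : zmodType)
    (rho : V -> V -> R) : Prop :=
  forall x y v, rho x y = rho (x + v) (y + v).

Definition induces_topology (R : realType) (T : topologicalType)
    (rho : T -> T -> R) : Prop :=
  forall A : set T, open A <->
    (forall x, A x -> exists2 e : R, 0 < e & [set y | rho x y < e] `<=` A).

Definition planar_metric (R : realType) (rho : R * R -> R * R -> R) : Prop :=
  [/\ is_metric rho, translation_invariant rho & induces_topology rho].

(* Compactness refers to the usual topology of the plane, which for a planar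
   metric is also the one given by rho. *)
Definition proper_metric (R : realType) (T : topologicalType)
    (rho : T -> T -> R) : Prop :=
  forall (x : T) (r : R), compact [set y | rho x y <= r].

Definition PLANARstar (R : realType) : set (\bar R) :=
  [set chi rho [set 1] | rho in
    [set rho : R * R -> R * R -> R | planar_metric rho /\ proper_metric rho]].

Arguments PLANARstar R : clear implicits.

(* Main.v *)
(* Write N v = rho 0 v, and call shell the set of v with 1 <= N v < 1 + e.  A
   discrete parity argument shows that some v in the shell is connected to -v
   inside it by steps of N-length less than e.  Translating this chain by
   multiples of 2v yields, through points 2jv + v - u with u in the shell, a
   chain from 0 to 2nv, which for n large (properness) leaves the unit ball; so
   it meets the shell, whence w = (2j+1)v - u with u, v, w in the shell and j
   bounded independently of e.  By compactness such a relation also holds with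
   N u = N v = N w = 1: a closed walk of odd length 2j+3 in the unit-distance
   graph. *)
Require Import Defs.
From HB Require Import structures.
From mathcomp Require Import all_boot all_order all_algebra.
From mathcomp Require Import all_classical all_reals all_analysis.
From mathcomp Require Import lra.

Set Implicit Arguments.
Unset Strict Implicit.
Unset Printing Implicit Defensive.

Import Order.TTheory GRing.Theory Num.Theory.
Import numFieldNormedType.Exports.

Local Open Scope classical_set_scope.
Local Open Scope ring_scope.

(** * Parity of signed sphere crossings on a grid *)

Section SignedCrossings.
Context (T : Type) (a s : T -> bool).

(** With [a] as membership in a ball, the edge counts when it leaves the ball and its outer end has
    sign [true]. *)
Definition signed_crossing (u v : T) : bool :=
  (a u (+) a v) && (if a u then s v else s u).

(** All outer corners share the sign [b] as soon as some corner is inner, so both sides are the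
    parity of the number of inner corners, multiplied by [b]. *)
Lemma signed_crossing_square (p q r t : T) :
  (exists b, forall x y, a y -> ~~ a x ->
     List.In x [:: p; q; r; t] -> List.In y [:: p; q; r; t] -> s x = b) ->
  signed_crossing p q (+) signed_crossing r t =
  signed_crossing p r (+) signed_crossing q t.
Proof.
move=> [b hb].
have {}hb x y : List.In x [:: p; q; r; t] -> List.In y [:: p; q; r; t] ->
    signed_crossing x y = (a x (+) a y) && b.
  move=> hx hy; rewrite /signed_crossing.
  case ax: (a x); case ay: (a y) => //=; apply: hb; eauto; by rewrite ?ax ?ay.
rewrite !hb /=; try tauto.
by case: (a p); case: (a q); case: (a r); case: (a t); case: b {hb}.
Qed.

(** A discrete Stokes formula: summed over the grid, the square identities cancel on interior edges,
    and the top and right sides, lying outside the ball, contribute nothing. *)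
Lemma signed_crossing_quadrant (p : nat -> nat -> T) (m : nat) :
  (forall i j, signed_crossing (p i j) (p i.+1 j) (+)
               signed_crossing (p i j.+1) (p i.+1 j.+1) =
               signed_crossing (p i j) (p i j.+1) (+)
               signed_crossing (p i.+1 j) (p i.+1 j.+1)) ->
  (forall i, ~~ a (p i m)) -> (forall j, ~~ a (p m j)) ->
  \big[addb/false]_(i < m) signed_crossing (p i 0%N) (p i.+1 0%N) =
  \big[addb/false]_(j < m) signed_crossing (p 0%N j) (p 0%N j.+1).
Proof.
move=> sq top right.
pose row j := \big[addb/false]_(i < m) signed_crossing (p i j) (p i.+1 j).
have strip j : row j = signed_crossing (p 0%N j) (p 0%N j.+1) (+) row j.+1.
  have aux n : \big[addb/false]_(i < n) signed_crossing (p i j) (p i.+1 j) =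
      signed_crossing (p 0%N j) (p 0%N j.+1) (+)
      signed_crossing (p n j) (p n j.+1) (+)
      \big[addb/false]_(i < n) signed_crossing (p i j.+1) (p i.+1 j.+1).
    elim: n => [|n IH]; first by rewrite !big_ord0 addbb.
    rewrite !big_ord_recr /= IH; move: (sq n j).
    move: (signed_crossing _ _) (signed_crossing (p n j.+1) _)
      (signed_crossing _ (p n j.+1)) (signed_crossing (p n.+1 j) _)
      (signed_crossing (p 0%N j) _) (bigop _ _ _).
    by do 6! case.
  rewrite /row aux [signed_crossing (p m j) _]/signed_crossing.
  by rewrite (negbTE (right j)) (negbTE (right j.+1)) /= addbF.
have rowE n : row 0%N = \big[addb/false]_(j < n)
    signed_crossing (p 0%N j) (p 0%N j.+1) (+) row n.
  elim: n => [|n IH]; first by rewrite big_ord0.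
  by rewrite big_ord_recr /= IH strip addbA.
rewrite -/(row 0%N) (rowE m) [row m]big1 ?addbF// => i _.
by rewrite /signed_crossing (negbTE (top i)) (negbTE (top i.+1)).
Qed.

End SignedCrossings.

(** * Antipodal points and chains in shells of a group norm *)

Record group_norm (R : realType) (V : zmodType) (N : V -> R) : Prop := {
  gnorm_ge0 : forall v, 0 <= N v ;
  gnorm0 : N 0 = 0 ;
  gnormN : forall v, N (- v) = N v ;
  gnormD : forall u v, N (u + v) <= N u + N v }.

Section Shell.
Context (R : realType) (V : zmodType) (N : V -> R) (gN : group_norm N).

Definition shell (e : R) (v : V) : bool := (1 <= N v) && (N v < 1 + e).

Definition shell_locally_constant (e : R) (s : V -> bool) : Prop :=
  forall x y, shell e x -> shell e y -> N (x - y) < e -> s x = s y.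

(* Being joined by a chain in the shell with steps of length less than e,
   encoded as indistinguishability by functions constant along such steps. *)
Definition shell_connected (e : R) (u v : V) : Prop :=
  forall s, shell_locally_constant e s -> s u = s v.

Lemma gnormB (u v : V) : N (u - v) = N (v - u).
Proof. by rewrite -[LHS](gnormN gN) opprB. Qed.

Lemma gnorm_le_dist (u v : V) : N u <= N v + N (u - v).
Proof. by rewrite -{1}(subrK v u) addrC; exact: (gnormD gN). Qed.

Lemma shellN e v : shell e (- v) = shell e v.
Proof. by rewrite /shell (gnormN gN). Qed.

(** A parallelogram with sides shorter than [e / 2] has diameter less than [e]; if one corner is in
    the unit ball, the outer corners therefore lie in the shell and share one sign. *)
Lemma shell_square (e : R) (s : V -> bool) (d d' w : V) :
  shell_locally_constant e s -> N d < e / 2 -> N d' < e / 2 ->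
  let cr := signed_crossing (fun v => N v < 1) s in
  cr w (w + d) (+) cr (w + d') (w + d + d') =
  cr w (w + d') (+) cr (w + d) (w + d + d').
Proof.
move=> hs hd hd' cr.
apply: signed_crossing_square.
set sq := [:: w; _; _; _].
have close x y : List.In x sq -> List.In y sq -> N (x - y) < e.
  have sqE z : List.In z sq -> exists a b : bool, z = w + (d *+ a + d' *+ b).
    rewrite /sq /= => -[<-|[<-|[<-|[<-|//]]]].
    - by exists false, false; rewrite !addr0.
    - by exists true, false; rewrite addr0.
    - by exists false, true; rewrite add0r.
    - by exists true, true; rewrite addrA.
  have small (z : V) (a b : bool) : N (z *+ a - z *+ b) <= N z.
    case: a b => -[]; rewrite ?subrr ?subr0 ?sub0r ?(gnormN gN) //;
    by rewrite (gnorm0 gN) (gnorm_ge0 gN).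
  move=> /sqE[a [b ->]] /sqE[a' [b' ->]].
  rewrite opprD addrACA subrr add0r opprD addrACA.
  apply: (le_lt_trans (gnormD gN _ _)).
  by move: (small d a a') (small d' b b'); lra.
(* Without an inner corner, or below without an outer one, the sign condition is vacuous and any [b]
   serves. *)
have [[y [ay yin]]|no] := pselect (exists y, N y < 1 /\ List.In y sq); last first.
  by exists true => x y ay _ _ yin; case: no; exists y.
have sh x : ~~ (N x < 1) -> List.In x sq -> shell e x.
  rewrite -leNgt /shell => ax xin; rewrite ax /=.
  by move: (close x y xin yin) (gnorm_le_dist x y); lra.
have [[z [az zin]]|no] := pselect (exists z, ~~ (N z < 1) /\ List.In z sq); last first.
  by exists true => x ? _ ax xin; case: no; exists x.
exists (s z) => x ? _ ax xin _; apply: hs; [exact: sh..|exact: close].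
Qed.

(* A Borsuk-Ulam statement: the shell cannot be split into two antipodal,
   separated halves.  Counting signed crossings of the unit sphere along the
   two halves of the horizontal axis gives the same parity, that of the
   vertical axis; but if the signs were odd, the two counts together would be
   the number of all crossings of a half-axis, which is odd. *)
Lemma no_odd_shell_sign (e : R) (s : V -> bool) (d d' : V) (m : nat) :
  N d < e / 2 -> N d' < e / 2 ->
  (forall i, 1 <= N (d *+ i + d' *+ m)) ->
  (forall i, 1 <= N (- d *+ i + d' *+ m)) ->
  (forall j, 1 <= N (d *+ m + d' *+ j)) ->
  (forall j, 1 <= N (- d *+ m + d' *+ j)) ->
  shell_locally_constant e s ->
  ~ (forall v, shell e v -> s (- v) = ~~ s v).
Proof.
move=> hd hd' top topN right rightN hs odd.
pose a v := N v < 1; pose p (z : V) i j := z *+ i + d' *+ j.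
(* Used for [z = d] and [z = - d]: the two quadrants share the vertical half-axis along [d']. *)
have quad z : N z < e / 2 -> (forall i, 1 <= N (z *+ i + d' *+ m)) ->
    (forall j, 1 <= N (z *+ m + d' *+ j)) ->
    \big[addb/false]_(i < m) signed_crossing a s (z *+ i) (z *+ i.+1) =
    \big[addb/false]_(j < m) signed_crossing a s (d' *+ j) (d' *+ j.+1).
  move=> hz t r.
  have := @signed_crossing_quadrant _ a s (p z) m.
  under eq_bigr do rewrite /p !addr0.
  under [in RHS]eq_bigr do rewrite /p !add0r.
  apply=> [i j|i|j]; rewrite /a /p -?leNgt//.
  have -> : z *+ i.+1 + d' *+ j = z *+ i + d' *+ j + z by rewrite mulrSr addrAC.
  have -> : z *+ i + d' *+ j.+1 = z *+ i + d' *+ j + d' by rewrite mulrSr addrA.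
  have -> : z *+ i.+1 + d' *+ j.+1 = z *+ i + d' *+ j + z + d'.
    by rewrite !mulrSr !addrA (addrAC _ z).
  exact: (shell_square _ hs hz hd').
have := quad d hd top right.
rewrite -(quad (- d)) ?(gnormN gN)// => /eqP; rewrite -negb_add.
rewrite -big_split /=.
(* A crossing and its mirror image have antipodal outer ends, of opposite signs, so exactly one of
   the two is counted. *)
have cr i : signed_crossing a s (d *+ i) (d *+ i.+1) (+)
     signed_crossing a s (- d *+ i) (- d *+ i.+1) =
     a (d *+ i) (+) a (d *+ i.+1).
  rewrite /signed_crossing !mulNrn /a !(gnormN gN).
  have step : N (d *+ i.+1 - d *+ i) < e.
    by rewrite mulrSr addrAC subrr add0r; move: (gnorm_ge0 gN d) hd; lra.
  have oddx x y : N x < 1 -> ~~ (N y < 1) -> N (y - x) < e -> s (- y) = ~~ s y.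
    rewrite -leNgt => x1 y1 xy; apply: odd; rewrite /shell y1 /=.
    by move: (gnorm_le_dist y x); lra.
  case x1: (N (d *+ i) < 1); case y1: (N (d *+ i.+1) < 1) => //=.
    by rewrite (oddx (d *+ i)) ?y1// addbN addbb.
  by rewrite (oddx (d *+ i.+1)) ?x1 1?gnormB// addbN addbb.
under eq_bigr do rewrite cr.
(* The sum telescopes; its ends are [0], inside the ball, and [d *+ m], outside, so the parity is
   odd. *)
have -> n : \big[addb/false]_(i < n) (a (d *+ i) (+) a (d *+ i.+1)) =
    a 0 (+) a (d *+ n).
  elim: n => [|n IH]; first by rewrite big_ord0 addbb.
  by rewrite big_ord_recr /= IH -addbA addKb.
have := right 0%N; rewrite addr0 /a (gnorm0 gN) ltr01 leNgt => /negbTE -> //.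
Qed.

(** Chain components of the shell then come in pairs of distinct antipodes; [s] selects one
    component of each pair. *)
Lemma odd_shell_sign (e : R) :
  (forall v, shell e v -> ~ shell_connected e v (- v)) ->
  exists2 s, shell_locally_constant e s &
             forall v, shell e v -> s (- v) = ~~ s v.
Proof.
move=> nc.
have csym u v : shell_connected e u v -> shell_connected e v u.
  by move=> h s hs; rewrite h.
have ctrans v u w : shell_connected e u v -> shell_connected e v w ->
    shell_connected e u w.
  by move=> h h' s hs; rewrite h ?h'.
have copp u v : shell_connected e u v -> shell_connected e (- u) (- v).
  move=> h s hs; apply: (h (s \o -%R)) => x y sx sy xy /=.
  by apply: hs; rewrite ?shellN// -opprD (gnormN gN).
pose orbit v := [set w | shell_connected e v w \/ shell_connected e (- v) w].
(* The choice depends only on the set [orbit v], hence is the same for [v], for [- v] and along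
   chains. As [orbit v] contains [v], the default [0] is harmless. *)
pose s v := `[< shell_connected e v (xget 0 (orbit v)) >].
have orbit_get v : orbit v (xget 0 (orbit v)).
  by apply: (@xgetPex _ 0 (orbit v)); exists v; left => s' hs'.
exists s => [x y sx sy xy|v sv].
  have cxy : shell_connected e x y by move=> s' hs'; exact: hs'.
  rewrite /s; have -> : orbit x = orbit y.
    apply/seteqP; split=> w [h|h]; [left|right|left|right].
    - exact: ctrans (csym _ _ cxy) h.
    - exact: ctrans (csym _ _ (copp _ _ cxy)) h.
    - exact: ctrans cxy h.
    - exact: ctrans (copp _ _ cxy) h.
  by apply: asbool_equiv_eq; split; apply: ctrans => //; exact: csym.
have oE : orbit (- v) = orbit v.
  by apply/seteqP; rewrite /orbit opprK; split=> w; rewrite /= orC.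
rewrite /s oE; set w := xget 0 _.
have [h|h] : orbit v w by exact: orbit_get.
  rewrite (asboolT h); apply: asboolF => h'.
  by apply: (nc v sv); apply: ctrans h _; exact: csym.
rewrite (asboolT h) asboolF// => h'.
by apply: (nc v sv); apply: ctrans h' _; exact: csym.
Qed.

Lemma shell_connected_walk (e : R) (n : nat) (v : V) :
  shell e v -> shell_connected e v (- v) ->
  (forall j u, (j < n)%N -> shell e u -> ~~ shell e (v *+ j.*2.+1 - u)) ->
  N (v *+ n.*2) < 1.
Proof.
move=> sv cv; elim: n => [|n IH] noz; first by rewrite (gnorm0 gN).
have vn : N (v *+ n.*2) < 1 by apply: IH => j u jn; apply: noz; exact: ltnW.
(* As [u] goes from [v] to [- v], the point [v *+ n.*2.+1 - u] goes from [v *+ n.*2] to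
   [v *+ n.+1.*2]. It avoids the shell and moves by less than [e], so it cannot leave the ball. *)
pose s u := N (v *+ n.*2.+1 - u) < 1.
have hs : shell_locally_constant e s.
  have half x y : shell e y -> N (x - y) < e -> s x -> s y.
    move=> sy xy sx; have := noz n y (ltnSn n) sy.
    rewrite /s /shell negb_and -ltNge -leNgt => /orP[//|].
    have := gnorm_le_dist (v *+ n.*2.+1 - y) (v *+ n.*2.+1 - x).
    rewrite opprB [in N (_ - y + _)]addrC addrA subrK.
    rewrite /s in sx; lra.
  move=> x y sx sy xy; apply/idP/idP; apply: half => //; by rewrite gnormB.
by move: (cv s hs); rewrite /s opprK -mulrSr -doubleS mulrSr addrK vn => <-.
Qed.

End Shell.

(** * The norm of a proper planar metric *)

Section PlanarNorm.
Context (R : realType) (rho : R * R -> R * R -> R).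
Hypotheses (hplanar : planar_metric rho) (hproper : proper_metric rho).

Let N (v : R * R) : R := rho 0 v.

Lemma planar_distE (x y : R * R) : rho x y = N (y - x).
Proof. by case: hplanar => _ inv _; rewrite (inv _ _ (- x)) subrr. Qed.

Lemma planar_group_norm : group_norm N.
Proof.
have [[ge0 eq0 sym tri] inv _] := hplanar.
split=> [v||v|u v]; first exact: ge0.
- by apply/eq0.
- by rewrite /N (inv _ _ v) add0r addNr sym.
- apply: (le_trans (tri _ u _)).
  by rewrite (planar_distE u) [u + v]addrC addrK.
Qed.

(** Balls of [rho] are open in the usual topology. *)
Lemma planar_norm_small (e : R) : 0 < e ->
  exists2 b : R, 0 < b & forall v : R * R, `|v| < b -> N v < e.
Proof.
move=> e0; have gN := planar_group_norm.
have [_ _ top] := hplanar.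
have oB : open [set y | N y < e].
  apply/top => x /= xe; exists (e - N x); first by rewrite subr_gt0.
  move=> y /=; rewrite planar_distE.
  by move: (gnorm_le_dist gN y x); lra.
have /nbhs_norm0P[b b0 hb] : nbhs (0 : R * R) [set y | N y < e].
  by apply: open_nbhs_nbhs; split=> //=; rewrite (gnorm0 gN).
by exists b => // v /hb.
Qed.

Lemma planar_norm_continuous : continuous N.
Proof.
have gN := planar_group_norm.
move=> x; apply/cvgrPdist_lt => e /planar_norm_small[b b0 hb].
apply/(@nbhs_normP R (R * R)%type); exists b => // y /= xy.
have := gnorm_le_dist gN x y; have := gnorm_le_dist gN y x.
have := hb _ xy; rewrite (gnormB gN y) => h1 h2 h3.
by rewrite ltr_norml; apply/andP; split; lra.
Qed.

Lemma planar_norm_large :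
  exists2 B : R, 0 < B & forall v : R * R, B <= `|v| -> 1 < N v.
Proof.
have /compact_bounded[B [_ hB]] := @hproper 0 1.
(* Only numbers strictly above [B] are known to bound the compact ball, whence [|B| + 1]; one more
   unit makes the contradiction strict. *)
exists (`|B| + 2) => [|v hv]; first by rewrite ltr_wpDl.
rewrite ltNge; apply/negP => v1.
have : `|v| <= `|B| + 1 by apply: hB => //; move: (ler_norm B); lra.
lra.
Qed.

(** The total defect [F] from the three equations attains its minimum on a compact set, and thin
    shells make it arbitrarily small. *)
Lemma shell_limit (k : nat) :
  (forall e, 0 < e -> exists u v : R * R,
     [/\ shell N e u, shell N e v & shell N e (v *+ k - u)]) ->
  exists u v : R * R, [/\ N u = 1, N v = 1 & N (v *+ k - u) = 1].
Proof.
move=> approx; have Ncont := planar_norm_continuous.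
(* Radius 2 contains every shell of thickness at most 1. *)
pose K := [set v : R * R | N v <= 2].
have cK : compact (K `*` K) by apply: compact_setX; exact: hproper.
pose F (p : (R * R) * (R * R)) :=
  `|N p.1 - 1| + `|N p.2 - 1| + `|N (p.2 *+ k - p.1) - 1|.
have contF : continuous F.
  have c1 : continuous (fun p : (R * R) * (R * R) => p.1).
    by move=> p; exact: cvg_fst.
  have c2 : continuous (fun p : (R * R) * (R * R) => p.2).
    by move=> p; exact: cvg_snd.
  have aux (g : (R * R) * (R * R) -> R * R) : continuous g ->
      continuous (fun p => `|N (g p) - 1|).
    move=> cg p; apply: cvg_norm; apply: cvgB; last exact: cvg_cst.
    by apply: (@continuous_comp _ _ _ g N); [exact: cg|exact: Ncont].
  move=> p; apply: cvgD; first apply: cvgD; [exact: aux..|].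
  apply: (aux (fun p => p.2 *+ k - p.1)) => {}p.
  apply: cvgB; last exact: c1.
  elim: {approx F}k => [|n IH]; first exact: cvg_cst.
  under eq_fun do rewrite mulrS.
  rewrite mulrS; apply: cvgD; [exact: c2|exact: IH].
have small e : 0 < e -> e <= 1 -> exists2 p, (K `*` K) p & F p < e *+ 3.
  move=> e0 e1; have [u [v [/andP[u1 u2] /andP[v1 v2] /andP[w1 w2]]]] := approx e e0.
  exists (u, v); first by split; rewrite /K /=; lra.
  rewrite /F /= !ger0_norm ?subr_ge0//; lra.
have ne : K `*` K !=set0 by have [p Kp _] := small 1 ltr01 (lexx 1); exists p.
have [[u v] _ hmin] :=
  compact_EVT_min ne cK (continuous_subspaceT contF).
suff F0 : F (u, v) = 0.
  exists u, v; move: F0; rewrite /F /= => F0.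
  have := normr_ge0 (N u - 1); have := normr_ge0 (N v - 1).
  have := normr_ge0 (N (v *+ k - u) - 1) => h1 h2 h3.
  by split; apply/eqP; rewrite -subr_eq0 -normr_eq0; apply/eqP; lra.
have F_ge0 : 0 <= F (u, v) by rewrite /F !addr_ge0.
apply/eqP; rewrite eq_le F_ge0 andbT leNgt; apply/negP => F_gt0.
(* Three defects below a quarter of the minimum would sum to less than the minimum. *)
have := @small (Num.min 1 (F (u, v) / 4)) _ _; case.
- by rewrite lt_min ltr01 divr_gt0.
- by rewrite ge_min lexx.
- move=> p Kp; have := hmin p (mem_set Kp).
  have : Num.min 1 (F (u, v) / 4) <= F (u, v) / 4 by rewrite ge_min lexx orbT.
  lra.
Qed.

(** By [shell_limit] each [k] has its own thickness; shells shrink with [e], so the minimum serves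
    finitely many [k] at once. *)
Lemma shell_separation (n : nat) :
  (forall k, (k < n)%N -> ~ exists u v : R * R,
     [/\ N u = 1, N v = 1 & N (v *+ k.*2.+1 - u) = 1]) ->
  exists2 e, 0 < e & forall (u v : R * R) k, (k < n)%N ->
    shell N e u -> shell N e v -> ~~ shell N e (v *+ k.*2.+1 - u).
Proof.
elim: n => [|n IH] no; first by exists 1.
have [e e0 he] : exists2 e, 0 < e & forall (u v : R * R) k, (k < n)%N ->
    shell N e u -> shell N e v -> ~~ shell N e (v *+ k.*2.+1 - u).
  by apply: IH => k kn; apply: no; exact: ltnW.
have [e' e'0 he'] : exists2 e, 0 < e & forall u v : R * R,
    shell N e u -> shell N e v -> ~~ shell N e (v *+ n.*2.+1 - u).
  apply: contrapT => h; apply: (no n (ltnSn n)); apply: shell_limit => e' e'0.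
  apply: contrapT => h'; apply: h; exists e' => // u v su sv.
  by apply/negP => sw; apply: h'; exists u, v.
exists (Num.min e e'); first by rewrite lt_min e0.
have mono d w : Num.min e e' <= d -> shell N (Num.min e e') w -> shell N d w.
  by rewrite /shell => led /andP[-> /=]; lra.
have le1 : Num.min e e' <= e by rewrite ge_min lexx.
have le2 : Num.min e e' <= e' by rewrite ge_min lexx orbT.
move=> u v k; rewrite ltnS leq_eqVlt => /orP[/eqP->|kn] su sv.
  by apply: contra (he' u v (mono _ _ le2 su) (mono _ _ le2 sv)); exact: mono.
by apply: contra (he u v k kn (mono _ _ le1 su) (mono _ _ le1 sv)); exact: mono.
Qed.

Lemma antipodal_shell_connected (e : R) : 0 < e ->
  exists2 v, shell N e v & shell_connected N e v (- v).
Proof.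
move=> e0; have gN := planar_group_norm.
apply: contrapT => h.
have [v sv cv|s hs odds] := @odd_shell_sign _ _ _ gN e.
  by apply: h; exists v.
have [b b0 hb] := planar_norm_small (divr_gt0 e0 (ltr0Sn R 1)).
have [B B0 hB] := planar_norm_large.
(* The grid has mesh [x], small enough that its steps have [N]-length below [e / 2]; [m] is then
   taken so large that the outer sides leave the unit ball. *)
pose x := b / 2.
have x0 : 0 < x by rewrite divr_gt0.
have [m hm] : exists m : nat, B <= x *+ m.
  exists (Num.bound (B / x)); rewrite -mulr_natr mulrC -ler_pdivrMr//.
  by apply/ltW/archi_boundP; rewrite divr_ge0// ltW.
have big (y z : R) : (B <= `|y|) || (B <= `|z|) -> 1 <= N (y, z).
  by move=> yz; apply/ltW/hB; rewrite prod_normE /= le_max.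
have mE (y z : R) i j : (y, 0) *+ i + (0, z) *+ j = (y *+ i, z *+ j) :> R * R.
  have pE (p : R * R) n : p *+ n = (p.1 *+ n, p.2 *+ n).
    by elim: n => [|n IH] //; rewrite !mulrS IH.
  by rewrite !pE /= !mul0rn; congr pair; rewrite ?addr0 ?add0r.
have nE : - (x, 0) = (- x, 0) :> R * R by congr pair; rewrite oppr0.
have nm : B <= `|x *+ m| by rewrite ger0_norm// mulrn_wge0// ltW.
have sx (y z : R) : `|y| < b -> `|z| < b -> N (y, z) < e / 2.
  by move=> yb zb; apply: hb; rewrite prod_normE gt_max yb.
have xb : `|x| < b by rewrite gtr0_norm// /x; lra.
apply: (@no_odd_shell_sign _ _ _ gN e s (x, 0) (0, x) m) => //.
- by apply: sx; rewrite ?normr0.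
- by apply: sx; rewrite ?normr0.
- by move=> i; rewrite mE; apply: big; rewrite nm orbT.
- by move=> i; rewrite nE mE; apply: big; rewrite nm orbT.
- by move=> i; rewrite mE; apply: big; rewrite nm.
- by move=> i; rewrite nE mE; apply: big; rewrite mulNrn normrN nm.
Qed.

Lemma odd_relation_exists :
  exists k (u v : R * R), [/\ N u = 1, N v = 1 & N (v *+ k.*2.+1 - u) = 1].
Proof.
have gN := planar_group_norm.
apply: contrapT => no.
have [b b0 hb] := planar_norm_small ltr01.
have [B B0 hB] := planar_norm_large.
(* Fixed before [e]: a shell vector has [1 <= N v], so its usual norm is at least [b], and
   [v *+ n.*2] is beyond [B] whatever the thickness. *)
pose n := Num.bound (B / b).
have nP : B <= b *+ n.
  rewrite -mulr_natr mulrC -ler_pdivrMr//.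
  by apply/ltW/archi_boundP; rewrite divr_ge0// ltW.
have [k _|e e0 he] := @shell_separation n.
  by case=> u [v huv]; apply: no; exists k, u, v.
have [v sv cv] := antipodal_shell_connected e0.
have := shell_connected_walk gN sv cv (fun j u jn su => he u v j jn su sv).
suff : 1 < N (v *+ n.*2) by lra.
apply: hB; have vb : b <= `|v|.
  by rewrite leNgt; apply/negP => /hb; case/andP: sv => ? _; lra.
rewrite normrMn; apply: (le_trans nP).
apply: (@le_trans _ _ (`|v| *+ n)); first by rewrite lerMn2r vb orbT.
by rewrite -addnn mulrnDr lerDl mulrn_wge0.
Qed.

(** * Colourings of the unit-distance graph *)

Lemma planar_unit_graph_not_2_colorable :
  ~ colorable (dist_graph rho [set 1]) 2.
Proof.
move=> [c hc]; have [k [u [v [u1 v1 w1]]]] := odd_relation_exists.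
have two (i j : 'I_2) : i <> j -> (i == ord0) = (j != ord0).
  by case: i j => -[|[|//]] i [[|[|//]] j] //= h; case: h; exact: val_inj.
have flip x y : N (y - x) = 1 -> (c y == ord0) = (c x != ord0).
  move=> d1; apply: two => /esym; apply: hc.
  by rewrite /dist_graph /= planar_distE.
(* Colours alternate along the closed walk through the multiples of [v] up to [v *+ k.*2.+1], then
   by [- u], then back to [0]; its length [2k + 3] is odd. *)
have walk n : (c (v *+ n) == ord0) = (c 0 == ord0) (+) odd n.
  elim: n => [|n IH]; first by rewrite addbF.
  rewrite (flip (v *+ n)) ?IH ?addbN//.
  by rewrite mulrS addrK.
have {}w1 : (c (v *+ k.*2.+1 - u) == ord0) = (c 0 != ord0).
  by apply: flip; rewrite subr0.
have := flip (v *+ k.*2.+1 - u) (v *+ k.*2.+1).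
rewrite opprB addrC subrK => /(_ u1).
by rewrite w1 walk /= odd_double addbT; case: (_ == _).
Qed.

End PlanarNorm.

Theorem theorem1p4 (R : realType) :
  (forall rho : R * R -> R * R -> R,
     planar_metric rho -> proper_metric rho ->
     (3%:E <= chi rho [set 1%R])%E) /\
  (forall k : \bar R, PLANARstar R k -> (2%:E < k)%E).
Proof.
have chi3 rho : planar_metric rho -> proper_metric rho ->
    (3%:E <= chi rho [set 1%R : R])%E.
  move=> hplanar hproper; apply: le_ereal_inf_tmp => _ [n [c hc] <-].
  rewrite lee_fin ler_nat leqNgt; apply/negP => n_lt3.
  apply: (planar_unit_graph_not_2_colorable hplanar hproper).
  (* [n < 3] is by computation the [n <= 2] that [widen_ord] expects. *)
  exists (fun x => @widen_ord n 2 n_lt3 (c x)) => x y /hc ne /(congr1 val) /= e.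
  by apply: ne; exact: val_inj.
split=> [//|_ [rho [hplanar hproper] <-]].
by apply: lt_le_trans (chi3 _ hplanar hproper); rewrite lte_fin ltr_nat.
Qed.
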